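(* For every integer $d \ge 11$, one has $S_d \neq P_d$, where $P_d$ is the set of $d\times d$ correlation matrices and $S_d$ is the set of $d \times d$ matrices of pairwise Spearman coefficients of $d$-dimensional random vectors with continuous margins.
   Context: For an integer $d\ge 1$, $P_d$ denotes the set of real symmetric positive semidefinite $d\times d$ matrices with unit diagonal (the elliptope, i.e. the set of $d\times d$ correlation matrices). For a random vector $(X_1,\dots,X_d)$ with continuous margins, where $X_i$ has (continuous) distribution function $F_i$, Spearman's rho of the pair $(X_i,X_j)$ is the Pearson correlation of the probability transforms $F_i(X_i)$ and $F_j(X_j)$. The Spearman matrix of the random vector is the $d\times d$ matrix of these pairwise coefficients, and $S_d$ denotes the set of all matrices that arise as the Spearman matrix of some $d$-dimensional random vector with continuous margins. Equivalently, $S_d$ is the set of correlation matrices of $d$-dimensional random vectors all of whose margins are the uniform law on $[-\sqrt{3},\sqrt{3}]$ (which has mean $0$ and variance $1$). *)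

(* Defs.v *)
From mathcomp Require Import all_boot all_order all_algebra.
From mathcomp Require Import all_classical all_reals all_analysis.

Set Implicit Arguments.
Unset Strict Implicit.
Unset Printing Implicit Defensive.

Import Order.TTheory GRing.Theory Num.Theory.
Import numFieldNormedType.Exports.

Local Open Scope classical_set_scope.
Local Open Scope ring_scope.

Definition psdmx (R : realType) (d : nat) (A : 'M[R]_d) : Prop :=
  A^T = A /\ forall x : 'cV[R]_d, 0 <= (x^T *m A *m x) 0 0.

(* The elliptope P_d. *)
Definition correlation_matrices (R : realType) (d : nat) : set 'M[R]_d :=
  [set A | psdmx A /\ forall i, A i i = 1].
Arguments correlation_matrices : clear implicits.

(* The moments are extended reals in the library. [fine] sends infinite values
   to 0, which is harmless below: [pearson] is only applied to variables with
   values in [0, 1], and [cdf] only takes values in [0, 1]. *)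
Definition pearson (disp : measure_display) (T : measurableType disp)
    (R : realType) (P : probability T R) (X Y : T -> R) : R :=
  fine (covariance P X Y) /
    (Num.sqrt (fine 'V_P[X]) * Num.sqrt (fine 'V_P[Y])).

Definition distribution_function (disp : measure_display)
    (T : measurableType disp) (R : realType) (P : probability T R)
    (X : {RV P >-> R}) : R -> R :=
  fun r => fine (cdf X r).

Definition probability_transform (disp : measure_display)
    (T : measurableType disp) (R : realType) (P : probability T R)
    (X : {RV P >-> R}) : T -> R :=
  distribution_function X \o X.

Definition spearman_rho (disp : measure_display) (T : measurableType disp)
    (R : realType) (P : probability T R) (X Y : {RV P >-> R}) : R :=
  pearson P (probability_transform X) (probability_transform Y).

Definition spearman_matrix (disp : measure_display) (T : measurableType disp)
    (R : realType) (P : probability T R) (d : nat)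
    (X : 'I_d -> {RV P >-> R}) : 'M[R]_d :=
  \matrix_(i, j) spearman_rho (X i) (X j).

(* The set S_d; the probability space carrying the random vector is arbitrary. *)
Definition spearman_matrices (R : realType) (d : nat) : set 'M[R]_d :=
  [set A | exists (disp : measure_display) (T : measurableType disp)
             (P : probability T R) (X : 'I_d -> {RV P >-> R}),
      (forall i, continuous (distribution_function (X i))) /\
      A = spearman_matrix X].
Arguments spearman_matrices : clear implicits.

(* Main.v *)
(* Eleven lines in R^4 carry a weighted spherical 5-design: unit vectors v_i and
   weights w_i with sum_i w_i <v_i, x>^4 = |x|^4, hence sum_i w_i v_i v_i^T = 2 I
   and sum_i w_i = 8. Suppose their Gram matrix, a correlation matrix of rank 4,
   is a Spearman matrix. The probability transforms, centred and scaled to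
   variance 1, are then almost surely of the form <v_i, Z> with E Z Z^T = I, and
   being uniform they have fourth moment 9/5. So E |Z|^4 = 8 * 9/5 = 14.4, which
   contradicts E |Z|^4 >= (E |Z|^2)^2 = 16. For d > 11 one vector is repeated. *)

Require Import Defs.
From HB Require Import structures.
From mathcomp Require Import all_boot all_order all_algebra.
From mathcomp Require Import all_classical all_reals all_analysis.
From mathcomp Require Import measurable_realfun ring lra.

Set Implicit Arguments.
Unset Strict Implicit.
Unset Printing Implicit Defensive.

Import Order.TTheory GRing.Theory Num.Theory.
Import numFieldNormedType.Exports.

Local Open Scope classical_set_scope.
Local Open Scope ring_scope.

(** * Bounded random variables and their means *)

Section bounded_random_variables.
Context (disp : measure_display) (T : measurableType disp) (R : realType).
Variable P : probability T R.
Implicit Types f g : T -> R.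

(** Boundedness is stable under polynomial operations and gives integrability under a probability,
    so all moments below exist. *)
Definition bounded_rv f := measurable_fun setT f /\ [bounded f x | x in setT].

Lemma bounded_rvP f : bounded_rv f <->
  measurable_fun setT f /\ exists M, forall x, `|f x| <= M.
Proof.
split=> -[mf].
  move=> [M [_ fM]]; split=> //; exists (M + 1) => x.
  by apply: fM => //; rewrite ltrDl.
move=> [M fM]; split=> //; exists M; split; first by rewrite num_real.
by move=> N MN x _; exact: le_trans (fM x) (ltW MN).
Qed.

Lemma bounded_rv_cst (a : R) : bounded_rv (fun=> a).
Proof. by apply/bounded_rvP; split=> //; exists `|a|. Qed.

Lemma bounded_rvD f g : bounded_rv f -> bounded_rv g ->
  bounded_rv (fun x => f x + g x).
Proof.
move=> /bounded_rvP[mf [M fM]] /bounded_rvP[mg [N gN]].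
apply/bounded_rvP; split; first exact: measurable_funD.
by exists (M + N) => x; rewrite (le_trans (ler_normD _ _))// lerD.
Qed.

Lemma bounded_rvM f g : bounded_rv f -> bounded_rv g ->
  bounded_rv (fun x => f x * g x).
Proof.
move=> /bounded_rvP[mf [M fM]] /bounded_rvP[mg [N gN]].
apply/bounded_rvP; split; first exact: measurable_funM.
by exists (M * N) => x; rewrite normrM ler_pM.
Qed.

Lemma bounded_rvB f g : bounded_rv f -> bounded_rv g ->
  bounded_rv (fun x => f x - g x).
Proof.
move=> bf bg; under eq_fun do rewrite -mulN1r.
by apply: bounded_rvD => //; apply: bounded_rvM => //; exact: bounded_rv_cst.
Qed.

Lemma bounded_rvX f n : bounded_rv f -> bounded_rv (fun x => f x ^+ n).
Proof.
move=> bf; elim: n => [|n IH]; first exact: bounded_rv_cst.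
by under eq_fun do rewrite exprS; exact: bounded_rvM.
Qed.

Lemma bounded_rv_sum (I : Type) (s : seq I) (F : I -> T -> R) :
  (forall i, bounded_rv (F i)) -> bounded_rv (fun x => \sum_(i <- s) F i x).
Proof.
move=> bF; elim: s => [|i s IH].
  by under eq_fun do rewrite big_nil; exact: bounded_rv_cst.
by under eq_fun do rewrite big_cons; exact: bounded_rvD.
Qed.

Lemma bounded_rv_integrable f :
  bounded_rv f -> P.-integrable setT (EFin \o f).
Proof.
move=> [mf bf]; apply: measurable_bounded_integrable => //.
by rewrite [X in (X < _)%E]probability_setT ltry.
Qed.

Lemma mean_cst (a : R) : \int[P]_x a = a.
Proof.
by rewrite Rintegral_cst// [X in fine X]probability_setT mulr1.
Qed.

Lemma meanD f g : bounded_rv f -> bounded_rv g ->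
  \int[P]_x (f x + g x) = \int[P]_x f x + \int[P]_x g x.
Proof. by move=> bf bg; rewrite RintegralD//; exact: bounded_rv_integrable. Qed.

Lemma meanB f g : bounded_rv f -> bounded_rv g ->
  \int[P]_x (f x - g x) = \int[P]_x f x - \int[P]_x g x.
Proof. by move=> bf bg; rewrite RintegralB//; exact: bounded_rv_integrable. Qed.

Lemma meanZ (a : R) f : bounded_rv f ->
  \int[P]_x (a * f x) = a * \int[P]_x f x.
Proof. by move=> bf; rewrite RintegralZl//; exact: bounded_rv_integrable. Qed.

Lemma mean_sum (I : Type) (s : seq I) (F : I -> T -> R) :
  (forall i, bounded_rv (F i)) ->
  \int[P]_x (\sum_(i <- s) F i x) = \sum_(i <- s) \int[P]_x F i x.
Proof.
move=> bF; elim: s => [|i s IH].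
  rewrite big_nil -[RHS](mean_cst 0).
  by apply: eq_Rintegral => x _; rewrite big_nil.
rewrite big_cons -IH -meanD//; last exact: bounded_rv_sum.
by apply: eq_Rintegral => x _; rewrite big_cons.
Qed.

(** The variance [E[(f - m)^2]] is nonnegative. *)
Lemma sqr_mean_le f : bounded_rv f ->
  (\int[P]_x f x) ^+ 2 <= \int[P]_x (f x ^+ 2).
Proof.
move=> bf; set m := \int[P]_x f x.
have : 0 <= \int[P]_x ((f x - m) ^+ 2).
  by apply: Rintegral_ge0 => x _; exact: sqr_ge0.
have -> : \int[P]_x ((f x - m) ^+ 2) =
    \int[P]_x ((f x ^+ 2 - (2 * m) * f x) + m ^+ 2).
  by apply: eq_Rintegral => x _; ring.
have bmf := bounded_rvM (bounded_rv_cst (2 * m)) bf.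
have bf2 := bounded_rvX 2 bf.
rewrite meanD; [|exact: bounded_rvB|exact: bounded_rv_cst].
rewrite meanB// meanZ// mean_cst -/m; lra.
Qed.

(** A nonnegative [f] of mean zero vanishes almost surely, so an identity valid on its zero set
    holds in mean. *)
Lemma mean0_transfer f g : bounded_rv f -> bounded_rv g ->
  (forall x, 0 <= f x) -> \int[P]_x f x = 0 ->
  (forall x, f x = 0 -> g x = 0) -> \int[P]_x g x = 0.
Proof.
move=> bf bg f0 intf0 fg; rewrite -(mean_cst 0) /Rintegral.
congr fine; apply: ae_eq_integral => //.
  by apply/measurable_EFinP; case: bg.
have mf : measurable_fun setT (EFin \o f) by apply/measurable_EFinP; case: bf.
have : ae_eq P setT (EFin \o f) (cst 0%E).
  apply/ae_eq_integral_abs => //.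
  have <- : (\int[P]_x (f x)%:E)%E = 0%E.
    by rewrite -[LHS]fineK ?(integrable_fin_num _ (bounded_rv_integrable bf))//
       -[fine _]/(\int[P]_x f x) intf0.
  by apply: eq_integral => x _ /=; rewrite ger0_norm.
by apply: filterS => x /(_ I)[fx0] _; rewrite fg.
Qed.

(* The matrix [B] below annihilates the covariance matrix, so almost surely
   [Y = V z] for some random [z]: then [S := \sum_i w_i Y_i ^ 2 = c |z|^2]
   while [\sum_i w_i Y_i ^ 4 = |z|^4], and one applies [E[S]^2 <= E[S^2]]. *)
Lemma design_fourth_moment (d n : nat) (V : 'M[R]_(d, n)) (w : 'rV[R]_d)
    (c s k : R) (Y : 'I_d -> T -> R) :
  (0 < n)%N -> 0 < c -> (forall i, (V *m V^T) i i = 1) ->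
  V^T *m diag_mx w *m V = c%:M ->
  (forall x : 'cV[R]_n,
    \sum_i w 0 i * (V *m x) i 0 ^+ 4 = (x^T *m x) 0 0 ^+ 2) ->
  (forall i, bounded_rv (Y i)) ->
  (forall i j, \int[P]_t (Y i t * Y j t) = s * (V *m V^T) i j) ->
  (forall i, \int[P]_t (Y i t ^+ 4) = k) ->
  s ^+ 2 * n%:R <= c * k.
Proof.
move=> n0 c0 V1 VwV V4 bY cov kurt.
(* The subtracted matrix is a projection onto the column space of [V], which is therefore the kernel
   of [B]. *)
pose B : 'M[R]_d := 1%:M - c^-1 *: (V *m V^T *m diag_mx w).
pose y t : 'cV[R]_d := \col_i Y i t.
have BV : B *m V = 0.
  rewrite mulmxBl mul1mx -scalemxAl -!mulmxA [V^T *m _]mulmxA VwV.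
  by rewrite mul_mx_scalar scalerA mulVf ?gt_eqF// scale1r subrr.
pose g t := \sum_i (B *m y t) i 0 ^+ 2.
pose S t := \sum_i w 0 i * Y i t ^+ 2.
pose F t := \sum_i w 0 i * Y i t ^+ 4.
have bcY a i m : bounded_rv (fun t => a * Y i t ^+ m).
  by apply: bounded_rvM; [exact: bounded_rv_cst|exact: bounded_rvX].
have bS : bounded_rv S by exact: bounded_rv_sum.
have bF : bounded_rv F by exact: bounded_rv_sum.
have gE t : g t = \sum_i \sum_j \sum_l B i j * B i l * (Y j t * Y l t).
  apply: eq_bigr => i _; rewrite expr2 mxE big_distrlr /=.
  by apply: eq_bigr => j _; apply: eq_bigr => l _; rewrite !mxE mulrACA.
have bg3 i j l : bounded_rv (fun t => B i j * B i l * (Y j t * Y l t)).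
  by apply: bounded_rvM; [exact: bounded_rv_cst|exact: bounded_rvM].
have bg2 i j : bounded_rv (fun t => \sum_l B i j * B i l * (Y j t * Y l t)).
  exact: bounded_rv_sum.
have bg1 i :
    bounded_rv (fun t => \sum_j \sum_l B i j * B i l * (Y j t * Y l t)).
  exact: bounded_rv_sum.
have bg : bounded_rv g.
  by rewrite (funext gE); exact: bounded_rv_sum.
(* [g] is [|B y|^2], and its mean is the trace of [s B V V^T B^T], zero because [B V = 0]. *)
have g0 : \int[P]_t g t = 0.
  under eq_Rintegral do rewrite gE.
  rewrite mean_sum//; apply: big1 => i _.
  rewrite mean_sum//.
  transitivity (s * (B *m V *m (B *m V)^T) i i); last first.
    by rewrite BV mul0mx mxE mulr0.
  rewrite trmx_mul mulmxA -[B *m V *m V^T]mulmxA mxE mulr_sumr.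
  transitivity (\sum_j \sum_l B i j * B i l * (s * (V *m V^T) j l)).
    apply: eq_bigr => j _; rewrite mean_sum//; apply: eq_bigr => l _.
    by rewrite meanZ ?cov//; exact: bounded_rvM.
  rewrite exchange_big /=; apply: eq_bigr => l _.
  rewrite [(B *m _) _ _]mxE mulr_suml mulr_sumr; apply: eq_bigr => j _.
  by rewrite [B^T _ _]mxE; ring.
have h0 : \int[P]_t (S t ^+ 2 - c ^+ 2 * F t) = 0.
  apply: (mean0_transfer bg _ _ g0) => [|t|t].
  - apply: bounded_rvB; first exact: bounded_rvX.
    by apply: bounded_rvM => //; exact: bounded_rv_cst.
  - by apply: sumr_ge0 => i _; exact: sqr_ge0.
  move=> /eqP; rewrite psumr_eq0; last by move=> i _; exact: sqr_ge0.
  move=> /allP gt0.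
  have By0 : B *m y t = 0.
    apply/matrixP => i j; rewrite ord1 [RHS]mxE; apply/eqP.
    by rewrite -sqrf_eq0; apply: (implyP (gt0 i _)).
  (* With this [z], the equation [B y = 0] reads [y = V z]. *)
  pose z : 'cV[R]_n := c^-1 *: (V^T *m diag_mx w *m y t).
  have yV : y t = V *m z.
    apply/eqP; rewrite -subr_eq0 -By0 mulmxBl mul1mx -scalemxAr -scalemxAl.
    by rewrite !mulmxA.
  have YE i : Y i t = (V *m z) i 0 by rewrite -yV mxE.
  have -> : F t = (z^T *m z) 0 0 ^+ 2.
    by rewrite -V4; apply: eq_bigr => i _; rewrite YE.
  have -> : S t = c * (z^T *m z) 0 0; last by ring.
  have -> : c * (z^T *m z) 0 0 = (z^T *m c%:M *m z) 0 0.
    by rewrite mul_mx_scalar -scalemxAl [RHS]mxE.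
  rewrite -VwV !mulmxA -mulmxA -trmx_mul mxE; apply: eq_bigr => i _.
  by rewrite YE mul_mx_diag !mxE expr2; ring.
(* Take traces in [V^T diag(w) V = c I]; the rows of [V] are unit vectors. *)
have cn : \sum_i w 0 i = c * n%:R.
  rewrite mulr_natr -mxtrace_scalar -VwV -mulmxA mxtrace_mulC.
  apply: eq_bigr => i _.
  by rewrite -mulmxA mul_diag_mx mxE V1 mulr1.
have ES : \int[P]_t S t = s * (c * n%:R).
  rewrite mean_sum// -cn mulr_sumr; apply: eq_bigr => i _.
  rewrite meanZ; last exact: bounded_rvX.
  under eq_Rintegral do rewrite expr2.
  by rewrite cov V1 mulr1 mulrC.
have EF : \int[P]_t F t = k * (c * n%:R).
  rewrite mean_sum// -cn mulr_sumr; apply: eq_bigr => i _.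
  rewrite meanZ; last exact: bounded_rvX.
  by rewrite kurt mulrC.
have := sqr_mean_le bS.
move: h0; rewrite meanB; [|exact: bounded_rvX|]; last first.
  by apply: bounded_rvM => //; exact: bounded_rv_cst.
rewrite meanZ// EF ES => /eqP; rewrite subr_eq0 => /eqP ->.
have n0' : 0 < n%:R :> R by rewrite ltr0n.
(* The positive factor [c^2 n] is common to both sides. *)
have -> : (s * (c * n%:R)) ^+ 2 = (s ^+ 2 * n%:R) * (c ^+ 2 * n%:R) by ring.
have -> : c ^+ 2 * (k * (c * n%:R)) = (c * k) * (c ^+ 2 * n%:R) by ring.
by rewrite ler_pM2r// mulr_gt0// exprn_gt0.
Qed.

End bounded_random_variables.

(** * A weighted spherical 5-design in dimension four *)

Section eleven_point_design.
Variable R : realType.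

Let r3 : R := Num.sqrt 3.
Let r6 : R := Num.sqrt 6.

Let r3E : r3 ^+ 2 = 3. Proof. by rewrite sqr_sqrtr. Qed.
Let r6E : r6 ^+ 2 = 6. Proof. by rewrite sqr_sqrtr. Qed.

(** Here [a^2 = 1/3] and [b^2 = 2/3]: both [3 a^2] and [a^2 + b^2] equal 1, which normalizes the
    points. *)
Let a : R := r3 / 3.
Let b : R := r6 / 3.

(* In R x R^3: the axis of the first factor, the four vertices of a regular
   tetrahedron in the second one, and the six vertices of an octahedron lifted
   along the axis. *)
Definition design_points : seq (seq R) :=
  [:: [:: 1; 0; 0; 0];
      [:: 0; a; a; a]; [:: 0; a; - a; - a];
      [:: 0; - a; a; - a]; [:: 0; - a; - a; a];
      [:: a; b; 0; 0]; [:: a; - b; 0; 0];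
      [:: a; 0; b; 0]; [:: a; 0; - b; 0];
      [:: a; 0; 0; b]; [:: a; 0; 0; - b]].

(** In the quartic form the fourth power of the axis coordinate gets [1/2 + 6 (3/4) a^4 = 1], that
    of any other coordinate [4 (3/4) a^4 + 2 (3/4) b^4 = 1]. *)
Definition design_weights : seq R := 1 / 2 :: nseq 10 (3 / 4).

(* Beyond the eleven design points the first one is repeated with weight 0,
   which is also the default value of [nth] for the weights. *)
Definition design_mx d : 'M[R]_(d, 4) :=
  \matrix_(i, j) (nth [:: 1; 0; 0; 0] design_points i)`_j.

Definition design_wt d : 'rV[R]_d := \row_i design_weights`_i.

Lemma sum_design_wt d (F : nat -> R) : (11 <= d)%N ->
  \sum_(i < d) design_wt d 0 i * F i =
  \sum_(i < 11) design_weights`_i * F i.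
Proof.
move=> d11; rewrite -(subnKC d11) big_split_ord /= [X in _ + X]big1 ?addr0.
  by apply: eq_bigr => i _; rewrite mxE.
by move=> i _; rewrite mxE nth_default ?mul0r.
Qed.

Lemma design_mx_unit d (i : 'I_d) : (design_mx d *m (design_mx d)^T) i i = 1.
Proof.
rewrite mxE; under eq_bigr do rewrite !mxE.
have : forall k, \sum_(j < 4) (nth [:: 1; 0; 0; 0] design_points k)`_j *
    (nth [:: 1; 0; 0; 0] design_points k)`_j = 1 :> R; last exact.
(* Twelve cases: the eleven points, and the default value past the end of the list. *)
by do 12?[case] => [||||||||||||k] /=;
  rewrite !big_ord_recl big_ord0 /= ?nth_nil /= /a /b; field: r3E r6E.
Qed.

(** The constant 2 is what the Laplacian of the quartic identity gives:
    [12 sum_i w_i <v_i, x>^2 = 24 |x|^2]. The proof checks the entries directly. *)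
Lemma design_mx_frame d : (11 <= d)%N ->
  (design_mx d)^T *m diag_mx (design_wt d) *m design_mx d = 2%:M.
Proof.
move=> d11; apply/matrixP => j l; rewrite mxE.
pose v i : seq R := nth [:: 1; 0; 0; 0] design_points i.
transitivity (\sum_(i < d) design_wt d 0 i * ((v i)`_j * (v i)`_l)).
  apply: eq_bigr => i _.
  by rewrite mul_mx_diag !mxE mulrA [_ * design_weights`_i]mulrC.
rewrite (@sum_design_wt _ (fun i => (v i)`_j * (v i)`_l))// !mxE.
rewrite !big_ord_recl big_ord0 /v /=.
by case: j => [[|[|[|[|//]]]] ?]; case: l => [[|[|[|[|//]]]] ?];
  rewrite /= /a /b; field: r3E r6E.
Qed.

Lemma design_mx_fourth d (x : 'cV[R]_4) : (11 <= d)%N ->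
  \sum_i design_wt d 0 i * (design_mx d *m x) i 0 ^+ 4 =
  (x^T *m x) 0 0 ^+ 2.
Proof.
move=> d11.
pose v i : seq R := nth [:: 1; 0; 0; 0] design_points i.
transitivity (\sum_(i < d) design_wt d 0 i *
    (\sum_(j < 4) (v i)`_j * x j 0) ^+ 4).
  apply: eq_bigr => i _; rewrite [(_ *m x) _ _]mxE.
  by under eq_bigr do rewrite mxE.
rewrite (@sum_design_wt _ (fun i => (\sum_(j < 4) (v i)`_j * x j 0) ^+ 4))//.
rewrite [in RHS]mxE; under [in RHS]eq_bigr do rewrite mxE.
rewrite 11!big_ord_recl big_ord0 !big_ord_recl !big_ord0 /v /= /a /b.
by field: r3E r6E.
Qed.

End eleven_point_design.

(** * The uniform law and its distribution function *)

(** By monotonicity, the value is at most every small [e > 0] when [r <= 0], and at least every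
    [1 - e] when [r >= 1]. *)
Lemma uniform_cdf_clamp (R : realType)
    (mu : probability (measurableTypeR R) R) :
  (forall u, 0 < u < 1 -> mu `]-oo, u]%classic = u%:E) ->
  forall r, mu `]-oo, r]%classic = (Num.max 0 (Num.min r 1))%:E.
Proof.
move=> mu01 r.
have mono x y : x <= y -> (mu `]-oo, x]%classic <= mu `]-oo, y]%classic)%E.
  by move=> xy; rewrite le_measure ?inE//; exact: subitvPr.
have [r0|r0] := leP r 0.
  have -> : Num.max 0 (Num.min r 1) = 0 :> R.
    by rewrite max_l// ge_min r0.
  apply/eqP; rewrite eq_le measure_ge0 andbT; apply/lee_addgt0Pr => e e0.
  rewrite add0e; have [e1|e1] := leP 1 e.
    by rewrite (le_trans (probability_le1 _ _))// lee_fin.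
  by rewrite -mu01 ?e0//; apply: mono; rewrite (le_trans r0)// ltW.
have [r1|r1] := ltP r 1; first by rewrite max_r ?mu01 ?r0 ?r1// ltW.
rewrite max_r ?ler01//; apply/eqP; rewrite eq_le probability_le1//=.
apply/lee_addgt0Pr => e e0; have [e1|e1] := leP 1 e.
  by rewrite (@le_trans _ _ e%:E) ?lee_fin// -[leLHS]add0e leeD2r.
have e01 : 0 < 1 - e < 1 by apply/andP; split; lra.
rewrite (@le_trans _ _ (mu `]-oo, (1 - e)%R]%classic + e%:E)%E)//.
  by rewrite mu01// -EFinD subrK.
by rewrite leeD2r// mono//; lra.
Qed.

(* A probability is determined by its cdf, and a cdf equal to the identity on
   ]0, 1[ is forced to be 0 on the left and 1 on the right. *)
Lemma uniform_law_unique (R : realType)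
    (mu nu : probability (measurableTypeR R) R) :
  (forall u, 0 < u < 1 -> mu `]-oo, u]%classic = u%:E) ->
  (forall u, 0 < u < 1 -> nu `]-oo, u]%classic = u%:E) ->
  forall A, measurable A -> mu A = nu A.
Proof.
move=> mu01 nu01 A mA.
(* Half-open intervals form a generating class closed under intersection, and the []-k, k]] exhaust
   the line. *)
apply: (@measure_unique _ R (measurableTypeR R) (@ocitv R)
  (fun k => `]- k%:R, k%:R]%classic) _ _ _ _ mu nu) => //.
- exact: ocitvI.
- by move=> k; exact: is_ocitv.
- apply/seteqP; split=> // x _; exists (Num.bound `|x|) => //=.
  have := archi_boundP (normr_ge0 x); rewrite ltr_norml in_itv /=.
  by move=> /andP[-> /ltW].
- move=> _ [[a b] _ <-] /=.
  have [ba|ab] := ltP a b; last first.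
    by rewrite set_itv_ge ?measure0// bnd_simp -leNgt.
  have -> : `]a, b]%classic = `]-oo, b] `\` `]-oo, a].
    apply/seteqP; split=> x /=; rewrite !in_itv /=.
      by move=> /andP[ax ->]; split=> //; apply/negP; rewrite -ltNge.
    by move=> [-> /negP]; rewrite -ltNge => ->.
  rewrite !measureD//; try by rewrite (le_lt_trans (probability_le1 _ _)) ?ltry.
  have -> : `]-oo, b] `&` `]-oo, a] = `]-oo, a]%classic.
    apply/setIidr => x /=; rewrite !in_itv /= => xa.
    by rewrite (le_trans xa)// ltW.
  have eqcdf r : mu `]-oo, r]%classic = nu `]-oo, r]%classic.
    by rewrite (uniform_cdf_clamp mu01) (uniform_cdf_clamp nu01).
  by congr (_ - _)%E; exact: eqcdf.
- by move=> k; rewrite (le_lt_trans (probability_le1 _ _)) ?ltry.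
Qed.

Lemma uniform_prob_cdf (R : realType) (u : R) : 0 < u < 1 ->
  uniform_prob (@ltr01 R) `]-oo, u]%classic = u%:E.
Proof.
move=> /andP[u0 u1]; rewrite /uniform_prob integral_uniform_pdf.
have -> : `]-oo, u] `&` `[0, 1] = `[0, u]%classic.
  apply/seteqP; split=> x /=; rewrite !in_itv /=; first by move=> [-> /andP[->]].
  by move=> /andP[-> xu]; rewrite xu (le_trans xu)// ltW.
rewrite (eq_integral (cst 1%E)); last first.
  move=> x; rewrite inE /= in_itv /= => /andP[x0 xu].
  by rewrite /uniform_pdf x0 (le_trans xu (ltW u1)) /= subr0 invr1.
by rewrite integral_cst//= mul1e lebesgue_measure_itv /= lte_fin u0 sube0.
Qed.

(** * The probability integral transform *)

Section probability_integral_transform.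
Context (disp : measure_display) (T : measurableType disp) (R : realType).
Variables (P : probability T R) (X : {RV P >-> R}).
Hypothesis contF : continuous (distribution_function X).

Let F := distribution_function X.
Let W := probability_transform X.

Lemma EFin_distribution_function r : (F r)%:E = cdf X r.
Proof. by rewrite fineK// fin_num_measure. Qed.

Lemma distribution_function_ge0 r : 0 <= F r.
Proof. by rewrite -lee_fin EFin_distribution_function cdf_ge0. Qed.

Lemma distribution_function_le1 r : F r <= 1.
Proof. by rewrite -lee_fin EFin_distribution_function cdf_le1. Qed.

Lemma distribution_function_nd : {homo F : x y / x <= y}.
Proof.
by move=> x y xy; rewrite -lee_fin !EFin_distribution_function cdf_nondecreasing.
Qed.

Lemma measurable_probability_transform : measurable_fun setT W.
Proof.
apply: measurableT_comp => //; apply: nondecreasing_measurable => //.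
exact: distribution_function_nd.
Qed.

(** Intermediate value theorem between the limits 0 and 1 at infinity. The endpoints 0 and 1 need
    not be attained. *)
Lemma distribution_function_surj u : 0 < u < 1 -> exists r, F r = u.
Proof.
move=> /andP[u0 u1].
have [a aF] : exists a, F a < u.
  have : F x @[x --> -oo] --> (0 : R) by exact/fine_cvg/cvg_cdfNy0.
  move=> /cvgrPdist_lt/(_ u u0)/filter_ex[a].
  by rewrite sub0r normrN ger0_norm ?distribution_function_ge0//; exists a.
have [b bF] : exists b, u < F b.
  have : F x @[x --> +oo] --> (1 : R) by exact/fine_cvg/cvg_cdfy1.
  have u1' : 0 < 1 - u by rewrite subr_gt0.
  move=> /cvgrPdist_lt/(_ _ u1')/filter_ex[b].
  rewrite ger0_norm ?subr_ge0 ?distribution_function_le1// => ub.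
  by exists b; lra.
have ab : a <= b.
  rewrite leNgt; apply/negP => /ltW /distribution_function_nd.
  by rewrite leNgt (lt_trans aF bF).
have cF : {within `[a, b], continuous F} by exact: continuous_subspaceT.
have [|r _ <-] := IVT ab cF (v := u); last by exists r.
by rewrite ge_min le_max (ltW aF) (ltW bF) orbT.
Qed.

Lemma probability_transform_cdf u : 0 < u < 1 ->
  P (W @^-1` `]-oo, u]) = u%:E.
Proof.
move=> u01; have mW : measurable (W @^-1` `]-oo, u]).
  by rewrite -[X in measurable X]setTI; exact: measurable_probability_transform.
have mX r : measurable (X @^-1` `]-oo, r]).
  by rewrite -[X in measurable X]setTI; exact: measurable_funPT.
apply/eqP; rewrite eq_le; apply/andP; split.
  (* [F] may be constant near level [u], so [r] is taken at level [u + e]: then [F(X) <= u] forces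
     [X <= r]. *)
  apply/lee_addgt0Pr => e e0.
  have [ue|ue] := leP 1 (u + e).
    by rewrite (le_trans (probability_le1 _ _))// -EFinD lee_fin.
  have [r rE] : exists r, F r = u + e.
    apply: distribution_function_surj; rewrite ue andbT.
    by rewrite addr_gt0//; case/andP: u01.
  rewrite -EFinD -rE EFin_distribution_function.
  apply: le_measure; rewrite ?inE// => x /=; rewrite !in_itv /= => Wu.
  rewrite leNgt; apply/negP => /ltW /distribution_function_nd.
  rewrite rE leNgt => /negP; apply; apply: le_lt_trans Wu _.
  by rewrite ltrDl.
have [r rE] := distribution_function_surj u01.
have -> : u%:E = P (X @^-1` `]-oo, r]).
  by rewrite -rE EFin_distribution_function.
apply: le_measure; rewrite ?inE// => x /=; rewrite !in_itv /= => Xr.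
by rewrite -rE; exact: distribution_function_nd.
Qed.

(* [R] and [measurableTypeR R] have the same measurable sets but different
   displays; [uniform_prob] lives on the latter. *)
Let W' : T -> measurableTypeR R := W.

#[local] HB.instance Definition _ :=
  @isMeasurableFun.Build _ _ _ _ W' measurable_probability_transform.

(** [W] is uniform on [[0, 1]]; the powers of [1 - W] match the known integral
    [Rintegral_onemXn]. *)
Lemma probability_transform_moment n :
  \int[P]_t (1 - W t) ^+ n = n.+1%:R^-1.
Proof.
(* The absolute value makes [f] nonnegative on the whole line, as the change of variables
   requires. *)
pose f x : \bar R := (`|1 - x| ^+ n)%:E.
have mf : measurable_fun setT f.
  apply/measurable_EFinP; apply: measurable_funX; apply: measurableT_comp => //.
  exact: measurable_funB.
have f0 x : (0 <= f x)%E by rewrite lee_fin exprn_ge0.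
rewrite -Rintegral_onemXn /Rintegral; congr fine.
transitivity (\int[P]_t (f \o W') t)%E.
  apply: eq_integral => t _ /=; rewrite /f ger0_norm//.
  by rewrite subr_ge0 distribution_function_le1.
rewrite -(ge0_integral_distribution (W' : {RV P >-> measurableTypeR R}))//.
transitivity (\int[uniform_prob (@ltr01 R)]_x f x)%E.
  apply: eq_measure_integral => A mA _; apply: uniform_law_unique => // u u01.
    exact: probability_transform_cdf.
  exact: uniform_prob_cdf.
rewrite integral_uniform// subr0 invr1 mul1e; apply: eq_integral => x.
by rewrite inE /= in_itv /= => /andP[x0 x1]; rewrite /f ger0_norm ?subr_ge0.
Qed.

End probability_integral_transform.

(** * Central moments of the transform *)

Section centred_probability_transform.
Context (disp : measure_display) (T : measurableType disp) (R : realType).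
Variables (P : probability T R) (X : {RV P >-> R}).
Hypothesis contF : continuous (distribution_function X).

Let W := probability_transform X.
(** Since [W - 1/2 = 1/2 - V], central moments expand binomially into the known moments of [V]. *)
Let V t := 1 - W t.

Lemma bounded_probability_transform : bounded_rv W.
Proof.
apply/bounded_rvP; split; first exact: measurable_probability_transform.
exists 1 => t; rewrite ger0_norm ?distribution_function_ge0//.
exact: distribution_function_le1.
Qed.

Let bV : bounded_rv V.
Proof.
apply: bounded_rvB; first exact: bounded_rv_cst.
exact: bounded_probability_transform.
Qed.

Let bVX a n : bounded_rv (fun t => a * V t ^+ n).
Proof. by apply: bounded_rvM; [exact: bounded_rv_cst|exact: bounded_rvX]. Qed.

Let EVX a n : \int[P]_t (a * V t ^+ n) = a / n.+1%:R.
Proof.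
rewrite meanZ; last exact: bounded_rvX.
by rewrite probability_transform_moment.
Qed.

Lemma bounded_centred_transform : bounded_rv (fun t => W t - 1 / 2).
Proof.
apply: bounded_rvB; first exact: bounded_probability_transform.
exact: bounded_rv_cst.
Qed.

Lemma mean_probability_transform : \int[P]_t W t = 1 / 2.
Proof.
transitivity (\int[P]_t (1 * V t ^+ 0 + -1 * V t ^+ 1)).
  by apply: eq_Rintegral => t _; rewrite /V; ring.
by rewrite meanD// !EVX; field.
Qed.

Lemma centred_transform_second_moment :
  \int[P]_t ((W t - 1 / 2) ^+ 2) = 1 / 12.
Proof.
transitivity (\int[P]_t
    ((1 * V t ^+ 2 + -1 * V t ^+ 1) + (1 / 4) * V t ^+ 0)).
  by apply: eq_Rintegral => t _; rewrite /V; field.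
rewrite meanD; [|exact: bounded_rvD|by []].
by rewrite meanD// !EVX; field.
Qed.

Lemma centred_transform_fourth_moment :
  \int[P]_t ((W t - 1 / 2) ^+ 4) = 1 / 80.
Proof.
transitivity (\int[P]_t
    ((1 * V t ^+ 4 + -2 * V t ^+ 3) + (3 / 2 * V t ^+ 2 +
     (- (1 / 2) * V t ^+ 1 + 1 / 16 * V t ^+ 0)))).
  by apply: eq_Rintegral => t _; rewrite /V; field.
have b10 : bounded_rv (fun t => - (1 / 2) * V t ^+ 1 + 1 / 16 * V t ^+ 0).
  exact: bounded_rvD.
rewrite meanD; [|exact: bounded_rvD..].
by rewrite !meanD// !EVX; field.
Qed.

End centred_probability_transform.

(** * Spearman's rho as a covariance, and the contradiction *)

(** Both transforms have mean 1/2 and variance 1/12, so the Pearson denominator is 1/12. *)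
Lemma spearman_rhoE (disp : measure_display) (T : measurableType disp)
    (R : realType) (P : probability T R) (X Y : {RV P >-> R}) :
  continuous (distribution_function X) ->
  continuous (distribution_function Y) ->
  \int[P]_t ((probability_transform X t - 1 / 2) *
             (probability_transform Y t - 1 / 2)) = 1 / 12 * spearman_rho X Y.
Proof.
move=> cX cY.
have covE (U V : {RV P >-> R}) : continuous (distribution_function U) ->
    continuous (distribution_function V) ->
    fine (covariance P (probability_transform U) (probability_transform V)) =
    \int[P]_t ((probability_transform U t - 1 / 2) *
               (probability_transform V t - 1 / 2)).
  move=> cU cV; rewrite covariance.unlock expectation.unlock.
  have EU := mean_probability_transform cU.
  have EV := mean_probability_transform cV.
  by rewrite /Rintegral in EU EV; rewrite EU EV.
have varE (U : {RV P >-> R}) : continuous (distribution_function U) ->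
    fine 'V_P[probability_transform U] = 1 / 12.
  by move=> cU; rewrite covE// -(centred_transform_second_moment cU).
rewrite /spearman_rho /pearson !varE// covE// -expr2 sqr_sqrtr ?divr_ge0//.
by field.
Qed.

Theorem theorem3p1 (R : realType) (d : nat) (hd : (11 <= d)%N) :
  spearman_matrices R d <> correlation_matrices R d.
Proof.
pose A : 'M[R]_d := design_mx R d *m (design_mx R d)^T.
have AC : correlation_matrices R d A.
  split; last exact: design_mx_unit.
  split=> [|x]; first by rewrite trmx_mul trmxK.
  have -> : x^T *m A *m x =
      ((design_mx R d)^T *m x)^T *m ((design_mx R d)^T *m x).
    by rewrite trmx_mul trmxK !mulmxA.
  by rewrite mxE; apply: sumr_ge0 => i _; rewrite mxE -expr2 sqr_ge0.
move=> SC; move: AC; rewrite -SC => -[disp [T [P [X [cX AE]]]]].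
(* Without rescaling to variance 1, the data are [s = 1/12], [n = 4], [c = 2], [k = 1/80];
   multiplied by 576, this false inequality reads [16 <= 14.4]. *)
have : (1 / 12) ^+ 2 * 4%:R <= 2 * (1 / 80) :> R; last lra.
apply: (@design_fourth_moment _ _ _ P _ _ (design_mx R d) (design_wt R d) _ _ _
  (fun i t => probability_transform (X i) t - 1 / 2)) => // [i||x|i|i j|i].
- exact: design_mx_unit.
- exact: design_mx_frame.
- exact: design_mx_fourth.
- exact: bounded_centred_transform.
- by rewrite spearman_rhoE// -/A AE mxE.
- exact: centred_transform_fourth_moment.
Qed.
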